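(* For uniform metrical task systems on $n$ states with access to a PST oracle whose prediction error in each phase is at most $\eta_0$, the robust LPS algorithm (which has no prior knowledge of $\eta_0$) has (expected) competitive ratio $\Theta(\min(\sqrt{\eta_0},\log n))$.
   Context: Uniform metrical task system: a finite set $S$ of $n$ states with $d(s,s')=1$ for $s\ne s'$ and $d(s,s)=0$. A task is a vector of $n$ nonnegative numbers $T[i]$, the cost of processing it in state $s_i$. One task arrives per (integer) time step; an online algorithm chooses at each time $t$ a (possibly random) state $\sigma(t)$, knowing only the tasks up to time $t$, its past states, and any oracle advice; its cost on a sequence is the sum of $d(\sigma(t-1),\sigma(t))$ and of the processing cost of the $t$-th task in $\sigma(t)$, with $\sigma(0)=s_1$. A (randomized) algorithm is $w$-competitive if, up to an additive constant, its expected cost is at most $w$ times the cost of the optimal offline algorithm on every input; its competitive ratio is the infimum of such $w$. Inputs consist of task sequences together with oracle predictions satisfying the error bound. Phases and saturation: at the start of a phase all states are unsaturated. A state $s$ is saturated at time $t$ if the total cost of processing, in state $s$, all tasks arriving from the start of the phase through time $t$ is at least $1$; its saturation time in the phase is the first such $t$. When all states are saturated the next phase begins and all states are again unsaturated. A BLS phase algorithm runs in phases, never processes tasks in a saturated state, and leaves its current state only when it becomes saturated. PST (Predicted Saturation Time) oracle: at the beginning of each phase it outputs an array $h$ of pairwise distinct integers, where $h[i]$ is the predicted saturation time of $s_i$ in that phase. If $t_i$ is the true saturation time of $s_i$ in the phase, the prediction error is $\eta=\sum_{i=1}^n |h[i]-t_i|$, and $\eta\le\eta_0$ is required in each phase.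 LPS (Last Predicted State) rule: at the beginning of each phase, and each time the current state becomes saturated while unsaturated states remain, transition to the unsaturated state with the latest predicted saturation time. Oblivious rule: each time the current state becomes saturated while unsaturated states remain, transition to an unsaturated state chosen uniformly at random. Robust LPS algorithm: in each phase, follow the LPS rule until the number of state transitions made in that phase reaches $H_n=\sum_{j=1}^n 1/j$, then follow the oblivious rule for the remainder of the phase. $\Theta(\cdot)$ is asymptotic in $\eta_0$ and $n$, with universal constants. *)

(* Defs.v *)
From HB Require Import structures.
From mathcomp Require Import all_boot all_order all_algebra.
From mathcomp Require Import all_classical all_reals all_analysis.

Set Implicit Arguments.
Unset Strict Implicit.
Unset Printing Implicit Defensive.

Import Order.TTheory GRing.Theory Num.Theory.
Local Open Scope classical_set_scope.
Local Open Scope ring_scope.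

(* Time: the initial state occupies time 0 and tasks arrive at times 1, 2, ...
   A task stream is T : nat -> S -> R; the value T 0 is never read.  Finite
   inputs are the prefixes T 1, ..., T N of streams.                          *)

Section Saturation.
Context {R : realType} {S : finType}.
Implicit Types (T : nat -> S -> R) (tau t : nat) (i : S).

Definition saturated T tau t i : bool := 1 <= \sum_(tau <= r < t.+1) T r i.

Definition unsaturated T tau t : {set S} := [set i | ~~ saturated T tau t i]%SET.

(* (index, starting time) of the phase that the task of time t belongs to; the
   task saturating the last state(s) is the last task of its phase.  Phases
   are numbered from 0, and at t = 0 the value is that of the first phase.    *)
Fixpoint phase T t : nat * nat :=
  if t isn't t'.+1 then (0, 1)%N else
  let: (k, tau) := phase T t' in
  if unsaturated T tau t' == finset.set0 then (k.+1, t'.+1) else (k, tau).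

Definition phase_index T t : nat := (phase T t).1.
Definition phase_start T t : nat := (phase T t).2.

Definition is_saturation_time T tau i t : Prop :=
  saturated T tau t i /\ forall t', (t' < t)%N -> ~~ saturated T tau t' i.

(* h k is the array output by the oracle at the beginning of phase k.  Every
   phase is the phase of some time t, so the bound is imposed on all of them;
   in particular every state gets saturated in every phase of the stream.     *)
Definition admissible (eta0 : R) T (h : nat -> S -> int) : Prop :=
  (forall t i, 0 <= T t i) /\
  forall t, (0 < t)%N ->
    injective (h (phase_index T t)) /\
    exists ts : S -> nat,
      (forall i, is_saturation_time T (phase_start T t) i (ts i)) /\
      (\sum_i `|h (phase_index T t) i - (ts i)%:Z|)%:~R <= eta0.

End Saturation.

Section Costs.
Context {R : realType} {S : finType}.
Variable s1 : S.
Implicit Types (T : nat -> S -> R) (h : nat -> S -> int).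

(* The state at time t of the trajectory s1, sigma_1, sigma_2, ... *)
Definition state_at (sigma : seq S) (t : nat) : S := nth s1 (s1 :: sigma) t.

Definition cost T (N : nat) (sigma : seq S) : R :=
  \sum_(1 <= t < N.+1)
    ((state_at sigma t.-1 != state_at sigma t)%:R + T t (state_at sigma t)).

Definition opt_cost T (N : nat) : R :=
  inf (range (fun sigma : N.-tuple S => cost T N sigma)).

(* A T h past s is the probability of choosing state s at time t = size past,
   given the past states past = [:: sigma(0); ...; sigma(t-1)].               *)
Definition algorithm : Type :=
  (nat -> S -> R) -> (nat -> S -> int) -> seq S -> S -> R.

Definition trajectory_prob (A : algorithm) T h (N : nat) (sigma : seq S) : R :=
  \prod_(1 <= t < N.+1) A T h (take t (s1 :: sigma)) (state_at sigma t).

Definition expected_cost (A : algorithm) T h (N : nat) : R :=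
  \sum_(sigma : N.-tuple S) trajectory_prob A T h N sigma * cost T N sigma.

(* The additive constant b must not depend on the input. *)
Definition competitive (eta0 : R) (A : algorithm) (w : R) : Prop :=
  exists b : R, forall T h, admissible eta0 T h -> forall N,
    expected_cost A T h N <= w * opt_cost T N + b.

Definition competitive_ratio (eta0 : R) (A : algorithm) : \bar R :=
  ereal_inf [set w%:E | w in competitive eta0 A].

End Costs.

Section RobustLPS.
Context {R : realType} {S : finType}.
Variable s1 : S.
Implicit Types (T : nat -> S -> R) (h : nat -> S -> int).

Definition harmonic_number (n : nat) : R := \sum_(1 <= j < n.+1) j%:R^-1.

Definition phase_transitions (past : seq S) (tau : nat) : nat :=
  \sum_(tau <= r < size past) (nth s1 past r.-1 != nth s1 past r).

(* A singleton when U is nonempty and p is injective. *)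
Definition latest_predicted (p : S -> int) (U : {set S}) : {set S} :=
  [set i in U | [forall j in U, p j <= p i]]%SET.

Definition cheapest (c : S -> R) : {set S} := [set i | [forall j, c i <= c j]]%SET.

(* States among which the next one is drawn uniformly.  At time t only T 1,
   ..., T t, the past states and the predictions of the current phase are
   read.  The last task of a phase cannot be processed in an unsaturated state
   and may be arbitrarily expensive: it is processed where it is cheapest.    *)
Definition robust_LPS_choices T h (past : seq S) : {set S} :=
  let t := size past in
  let s := last s1 past in
  let tau := phase_start T t in
  let U := unsaturated T tau t in
  if U == finset.set0 then cheapest (T t)
  else if (t != tau) && (s \in U) then [set s]%SET
  else if (phase_transitions past tau)%:R < harmonic_number #|S|
       then latest_predicted (h (phase_index T t)) U
  else U.

Definition robust_LPS : algorithm := fun T h past s =>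
  let C := robust_LPS_choices T h past in
  if s \in C then (#|C|%:R : R)^-1 else 0.

End RobustLPS.

(* Main.v *)
Require Import Defs.
From HB Require Import structures.
From mathcomp Require Import all_boot all_order all_algebra.
From mathcomp Require Import all_classical all_reals all_analysis.
From mathcomp Require Import zify ring lra.

(** Every phase costs the offline optimum at least 1, and the last task of a
    phase costs it at least the minimal entry of that task.  For the upper bound
    it thus suffices to bound the expected number of transitions per phase.

    The oblivious rule picks uniformly among r unsaturated states, of which the
    one of rank k leaves at most k unsaturated states when it saturates, so it
    makes H_r expected transitions by sum_(k < r) H_k = r H_r - r; with at most
    H_n + 1 LPS transitions before it, a phase costs O(H_n).  Along consecutive
    LPS transitions the saturation times increase and the predictions decrease,
    so the differences between the two grow by at least 2 each time and k visited
    states force an error of order k^2.  Hence if H_n > 2 sqrt eta0, the LPS rule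
    is never abandoned and a phase costs O(sqrt eta0).  Both cases are handled by
    one potential function.

    For the lower bound, unit tasks hit the states cyclically, so each phase lasts
    n steps and staying put costs 1 per phase, while the predictions reverse the
    last K ~ min (sqrt eta0, ln n) saturation times of each phase.  The total
    error is at most K^2 and the LPS rule walks through all K states. *)

Set Implicit Arguments.
Unset Strict Implicit.
Unset Printing Implicit Defensive.

Import Order.TTheory GRing.Theory Num.Theory.
Local Open Scope ring_scope.

(** * Harmonic numbers and logarithms *)

Section Harmonic.
Context {R : realType}.
Implicit Types n : nat.
Local Notation H := (@harmonic_number R).

Lemma harmonic_number0 : H 0 = 0.
Proof. by rewrite /harmonic_number big_geq. Qed.

Lemma harmonic_numberS n : H n.+1 = H n + n.+1%:R^-1.
Proof. by rewrite /harmonic_number big_nat_recr. Qed.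

Lemma harmonic_number_ge0 n : 0 <= H n.
Proof. by apply: sumr_ge0 => i _; rewrite invr_ge0. Qed.

Lemma harmonic_number_homo : {homo H : m n / (m <= n)%N >-> m <= n}.
Proof.
apply: homo_leq => // [x y z|n]; first exact: le_trans.
by rewrite harmonic_numberS lerDl invr_ge0.
Qed.

Lemma harmonic_number_ge1 n : (0 < n)%N -> 1 <= H n.
Proof.
move=> n0; apply: le_trans (harmonic_number_homo n0).
by rewrite harmonic_numberS harmonic_number0 add0r invr1.
Qed.

Lemma sum_harmonic_number n :
  \sum_(0 <= k < n) H k = n%:R * H n - n%:R.
Proof.
elim: n => [|n IH]; first by rewrite big_geq // mul0r subr0.
rewrite big_nat_recr //= IH harmonic_numberS mulrDr divff ?pnatr_eq0 //.
by rewrite -natr1; ring.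
Qed.

Lemma ln_harmonic_number n : ln n.+1%:R <= H n.
Proof.
elim: n => [|n IH]; first by rewrite ln1 harmonic_number0.
have -> : n.+2%:R = n.+1%:R * (1 + n.+1%:R^-1) :> R.
  by rewrite mulrDr mulr1 divff ?pnatr_eq0 // natr1.
have n1 : (0 : R) < n.+1%:R^-1 by rewrite invr_gt0 ltr0n.
rewrite lnM ?posrE ?ltr0n ?addr_gt0 // harmonic_numberS lerD //.
by apply: le_ln1Dx; apply: lt_trans n1; lra.
Qed.

Lemma harmonic_number_ln n : H n.+1 <= 1 + ln n.+1%:R.
Proof.
elim: n => [|n IH].
  by rewrite harmonic_numberS harmonic_number0 add0r invr1 ln1 addr0.
rewrite harmonic_numberS.
have n2 : (n.+2%:R : R)^-1 < 1 by rewrite invf_lt1 ?ltr0n // ltr1n.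
have ln_step : ln n.+2%:R = ln n.+1%:R - ln (1 - n.+2%:R^-1) :> R.
  rewrite -ln_div ?posrE ?ltr0n ?subr_gt0 //; congr (ln _).
  have -> : 1 - n.+2%:R^-1 = n.+1%:R / n.+2%:R :> R.
    by rewrite -[X in X - _](@divff R n.+2%:R) ?pnatr_eq0 // -[X in _ - X]mul1r -mulrBl -(natr1 n.+1) addrK.
  by rewrite invf_div mulrCA divff ?mulr1 // pnatr_eq0.
have ln_le : ln (1 - n.+2%:R^-1) <= - (n.+2%:R : R)^-1.
  by apply: le_ln1Dx; rewrite ltrN2.
by rewrite ln_step addrA; apply: lerD; rewrite // lerNr.
Qed.

(** Keeps the logarithm away from 0 for at least two states, so that additive constants are absorbed
    by a multiple of it. *)
Lemma ln2_ge_half : (2^-1 : R) <= ln 2.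
Proof.
have : ln (1 + (- 2^-1)) <= - (2 : R)^-1 by apply: le_ln1Dx; lra.
have -> : 1 + - 2^-1 = (2 : R)^-1 by lra.
by rewrite lnV ?posrE //; lra.
Qed.

End Harmonic.

(** * Expected costs of randomized algorithms by drift arguments *)

Section Trajectories.
Context {R : realType} {S : finType}.
Context (s1 : S).
Implicit Types (A : @algorithm R S) (T : nat -> S -> R) (h : nat -> S -> int).
Implicit Types (past sigma : seq S).

Lemma sum_tuple_rcons N (F : seq S -> R) :
  \sum_(sigma : N.+1.-tuple S) F sigma =
  \sum_(sigma : N.-tuple S) \sum_s F (rcons sigma s).
Proof.
rewrite pair_big /=; pose f (p : N.-tuple S * S) := rcons_tuple p.1 p.2.
apply: (reindex f); apply: onW_bij; apply: inj_card_bij => [[u x] [v y] fuv|].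
  by have [/val_inj -> ->] := rcons_inj (congr1 val fuv).
by rewrite card_prod !card_tuple expnSr.
Qed.

Lemma trajectory_prob_rcons (A : @algorithm R S) T h N sigma s : size sigma = N ->
  trajectory_prob s1 A T h N.+1 (rcons sigma s) =
  trajectory_prob s1 A T h N sigma * A T h (s1 :: sigma) s.
Proof.
move=> sN; rewrite /trajectory_prob big_nat_recr //=; congr (_ * _).
  apply: eq_big_nat => t /andP[_ tN]; rewrite /state_at -rcons_cons nth_rcons -cats1.
  by rewrite takel_cat /= sN ?tN // ltnW.
rewrite /state_at /= nth_rcons sN ltnn eqxx -cats1 takel_cat ?sN //.
by rewrite take_oversize ?sN.
Qed.

Definition step_cost T past s : R :=
  (last s1 past != s)%:R + T (size past) s.

Lemma cost_rcons T N sigma s : size sigma = N ->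
  cost s1 T N.+1 (rcons sigma s) = cost s1 T N sigma + step_cost T (s1 :: sigma) s.
Proof.
move=> sN; rewrite /cost big_nat_recr //=; congr (_ + _).
  apply: eq_big_nat => t /andP[t0 tN]; rewrite /state_at -rcons_cons !nth_rcons /= sN.
  by rewrite tN (leq_ltn_trans (leq_pred t)).
rewrite /state_at /step_cost -rcons_cons !nth_rcons /= sN ltnn eqxx ltnSn.
by rewrite -sN nth_last.
Qed.

Definition randomized (A : @algorithm R S) T h : Prop :=
  (forall past s, 0 <= A T h past s) /\ (forall past, \sum_s A T h past s = 1).

Lemma trajectory_prob_ge0 A T h N sigma : randomized A T h ->
  0 <= trajectory_prob s1 A T h N sigma.
Proof. by case=> A0 _; apply: prodr_ge0. Qed.

Lemma trajectory_prob_total A T h N : randomized A T h ->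
  \sum_(sigma : N.-tuple S) trajectory_prob s1 A T h N sigma = 1.
Proof.
move=> [A0 A1]; elim: N => [|N IH].
  rewrite (eq_bigr (fun=> 1)) => [|i _]; last by rewrite /trajectory_prob big_geq.
  by rewrite sumr_const card_tuple expn0.
rewrite sum_tuple_rcons -[RHS]IH; apply: eq_bigr => sigma _.
under eq_bigr do rewrite trajectory_prob_rcons ?size_tuple //.
by rewrite -mulr_sumr A1 mulr1.
Qed.

(** Preservation is asked only along choices of positive probability: other trajectories have weight
    0 in every expectation. *)
Definition reachable_invariant A T h (Inv : seq S -> Prop) : Prop :=
  Inv [:: s1] /\ forall past s, (0 < size past)%N -> Inv past ->
    A T h past s != 0 -> Inv (rcons past s).

Lemma trajectory_prob_invariant A T h N (sigma : seq S) Inv :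
  reachable_invariant A T h Inv -> size sigma = N ->
  trajectory_prob s1 A T h N sigma != 0 -> Inv (s1 :: sigma).
Proof.
move=> [I0 IS]; elim: N sigma => [|N IH] sigma; first by move/size0nil ->.
case/lastP: sigma => // sigma s; rewrite size_rcons => -[sN].
rewrite trajectory_prob_rcons // mulf_eq0 negb_or => /andP[/(IH _ sN) Is As].
by rewrite -rcons_cons; apply: IS.
Qed.

(** Supermartingale argument: given the past, [G] grows on average by at most [X t] at time [t];
    summing over the last state first gives the induction step. *)
Lemma expectation_drift A T h (Inv : seq S -> Prop) (G : seq S -> R) (X : nat -> R) N :
  randomized A T h -> reachable_invariant A T h Inv ->
  (forall past, (0 < size past)%N -> Inv past ->
    \sum_s A T h past s * G (rcons past s) <= G past + X (size past)) ->
  \sum_(sigma : N.-tuple S) trajectory_prob s1 A T h N sigma * G (s1 :: sigma) <=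
    G [:: s1] + \sum_(1 <= t < N.+1) X t.
Proof.
move=> rA rI drift; elim: N => [|N IH].
  rewrite big_geq // addr0 (eq_bigr (fun=> G [:: s1])) => [|i _]; last first.
    by rewrite /trajectory_prob big_geq // mul1r tuple0.
  by rewrite sumr_const card_tuple expn0.
rewrite big_nat_recr //= addrA.
rewrite (sum_tuple_rcons N (fun sg => trajectory_prob s1 A T h N.+1 sg * G (s1 :: sg))).
apply: le_trans (_ : _ <= \sum_(sigma : N.-tuple S)
    trajectory_prob s1 A T h N sigma * (G (s1 :: sigma) + X N.+1)) _.
  apply: ler_sum => sigma _.
  under eq_bigr do rewrite trajectory_prob_rcons ?size_tuple // -mulrA -rcons_cons.
  rewrite -mulr_sumr; have [->|pn0] := eqVneq (trajectory_prob s1 A T h N sigma) 0.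
    by rewrite !mul0r.
  rewrite ler_wpM2l ?trajectory_prob_ge0 //.
  have := drift (s1 :: sigma); rewrite /= size_tuple; apply => //.
  by apply: trajectory_prob_invariant rI _ pn0; rewrite size_tuple.
under [leLHS]eq_bigr do rewrite mulrDr.
by rewrite big_split -mulr_suml trajectory_prob_total // mul1r lerD2r.
Qed.

(** Amortized analysis: the drift bound is applied to the cost so far plus [Phi], and the final
    potential is dropped because it is nonnegative. *)
Lemma expected_cost_le A T h (Inv : seq S -> Prop) (Phi : seq S -> R) (X : nat -> R) N :
  randomized A T h -> reachable_invariant A T h Inv ->
  (forall past, 0 <= Phi past) ->
  (forall past, (0 < size past)%N -> Inv past ->
    \sum_s A T h past s * (step_cost T past s + Phi (rcons past s)) <=
      Phi past + X (size past)) ->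
  expected_cost s1 A T h N <= Phi [:: s1] + \sum_(1 <= t < N.+1) X t.
Proof.
move=> rA rI Phi0 drift.
pose G past := cost s1 T (size past).-1 (behead past) + Phi past.
apply: le_trans (_ : _ <= \sum_(sigma : N.-tuple S)
    trajectory_prob s1 A T h N sigma * G (s1 :: sigma)) _.
  apply: ler_sum => sigma _; rewrite ler_wpM2l ?trajectory_prob_ge0 //.
  by rewrite /G /= size_tuple lerDl.
have -> : Phi [:: s1] = G [:: s1] by rewrite /G /cost big_geq // add0r.
(* [cost] takes the trajectory without its initial state, so the invariant also records that the
   past starts with [s1]. *)
apply: (expectation_drift (Inv := fun past => Inv past /\ past = s1 :: behead past)) => //.
  split=> [|past s past0 [Ip ep] As]; first by split=> //; case: rI.
  by split; [apply: (proj2 rI) | rewrite {1}ep; case: (past) past0].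
case=> // x sigma _ [Ip [ex]]; rewrite {}ex in Ip *.
have Gr s : G (rcons (s1 :: sigma) s) = cost s1 T (size sigma) sigma +
    (step_cost T (s1 :: sigma) s + Phi (rcons (s1 :: sigma) s)).
  by rewrite /G size_rcons /= cost_rcons // -[LHS]addrA.
under eq_bigr do rewrite Gr mulrDr.
rewrite big_split -mulr_suml (proj2 rA) mul1r /G /= -addrA lerD2l.
exact: drift.
Qed.

(** Minus the cost so far has drift at most [- X t], so the same drift bound yields lower bounds on
    costs. *)
Lemma expected_cost_ge A T h (Inv : seq S -> Prop) (X : nat -> R) N :
  randomized A T h -> reachable_invariant A T h Inv ->
  (forall past s, (0 < size past)%N -> Inv past -> A T h past s != 0 ->
    X (size past) <= step_cost T past s) ->
  \sum_(1 <= t < N.+1) X t <= expected_cost s1 A T h N.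
Proof.
move=> rA rI step.
pose G past := - cost s1 T (size past).-1 (behead past).
have EG : expected_cost s1 A T h N = - \sum_(sigma : N.-tuple S)
    trajectory_prob s1 A T h N sigma * G (s1 :: sigma).
  rewrite -sumrN; apply: eq_bigr => sigma _.
  by rewrite /G /= size_tuple mulrN opprK.
have G0 : G [:: s1] = 0 by rewrite /G /cost big_geq ?oppr0.
rewrite EG lerNr -[leRHS]add0r -[X in _ <= X + _]G0 -sumrN.
apply: (expectation_drift (Inv := fun past => Inv past /\ past = s1 :: behead past)
  (G := G) (X := fun t => - X t)) => //.
  split=> [|past s past0 [Ip ep] As]; first by split=> //; case: rI.
  by split; [apply: (proj2 rI) | rewrite {1}ep; case: (past) past0].
case=> // x sigma _ [Ip [ex]]; rewrite {}ex in Ip *.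
rewrite -[leRHS]mul1r -(proj2 rA (s1 :: sigma)) mulr_suml; apply: ler_sum => s _.
have [->|As] := eqVneq (A T h (s1 :: sigma) s) 0; first by rewrite !mul0r.
rewrite ler_wpM2l ?(proj1 rA) // /G size_rcons /= cost_rcons // opprD lerD2l lerN2.
exact: step Ip As.
Qed.

Lemma opt_cost_ge T N B :
  (forall sigma : N.-tuple S, B <= cost s1 T N sigma) -> B <= opt_cost s1 T N.
Proof.
move=> B_lb; apply: lb_le_inf; first by exists (cost s1 T N (nseq N s1)), (nseq_tuple N s1).
by move=> _ [sigma _ <-].
Qed.

Lemma opt_cost_le T N (sigma : N.-tuple S) : (forall t i, 0 <= T t i) ->
  opt_cost s1 T N <= cost s1 T N sigma.
Proof.
move=> T0; apply: ge_inf; last by exists sigma.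
exists 0 => _ [tau _ <-]; apply: sumr_ge0 => t _; exact: addr_ge0.
Qed.

Lemma opt_cost_le_expected_cost A T h N : randomized A T h ->
  (forall t i, 0 <= T t i) -> opt_cost s1 T N <= expected_cost s1 A T h N.
Proof.
move=> rA T0; rewrite -[leLHS]mul1r -(trajectory_prob_total N rA) mulr_suml.
apply: ler_sum => sigma _; apply: ler_wpM2l; [exact: trajectory_prob_ge0|exact: opt_cost_le].
Qed.

End Trajectories.

(** * Phases, offline lower bounds and saturation times *)

Section Phases.
Context {R : realType} {S : finType}.
Context (s1 : S).
Implicit Types (T : nat -> S -> R) (h : nat -> S -> int) (tau t : nat) (i : S).

Definition work T tau t i : R := \sum_(tau <= r < t.+1) T r i.

Definition phase_end T t : bool := unsaturated T (phase_start T t) t == finset.set0.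

Lemma phaseS_stay T t : ~~ phase_end T t -> phase T t.+1 = phase T t.
Proof.
rewrite /phase_end /phase_start /=; case: (phase T t) => k tau /=.
by move/negPf ->.
Qed.

Lemma phaseS_end T t : phase_end T t -> phase T t.+1 = ((phase_index T t).+1, t.+1).
Proof.
rewrite /phase_end /phase_start /phase_index /=; case: (phase T t) => k tau /=.
by move->.
Qed.

Lemma phase_start_stay T t : ~~ phase_end T t -> phase_start T t.+1 = phase_start T t.
Proof. by move=> /phaseS_stay; rewrite /phase_start => ->. Qed.

Lemma phase_index_stay T t : ~~ phase_end T t -> phase_index T t.+1 = phase_index T t.
Proof. by move=> /phaseS_stay; rewrite /phase_index => ->. Qed.

Lemma phase_start_end T t : phase_end T t -> phase_start T t.+1 = t.+1.
Proof. by move=> /phaseS_end; rewrite /phase_start => ->. Qed.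

Lemma phase_start1 T : phase_start T 1 = 1%N.
Proof. by rewrite /phase_start /=; case: ifP. Qed.

Lemma phase_start_le T t : (0 < t)%N -> (phase_start T t <= t)%N.
Proof.
case: t => // t _; elim: t => [|t IH]; first by rewrite phase_start1.
have [/phase_start_end ->//|/phase_start_stay ->] := boolP (phase_end T t.+1).
exact: leqW.
Qed.

Lemma work_empty T t i : (0 < t)%N -> work T t t.-1 i = 0.
Proof. by case: t => // t _; rewrite /work big_geq. Qed.

Lemma work_recr T tau t i : (0 < t)%N -> (tau <= t)%N ->
  work T tau t i = work T tau t.-1 i + T t i.
Proof. by case: t => // t _ tau_t; rewrite /work big_nat_recr. Qed.

Lemma work_ge0 T tau t i : (forall t i, 0 <= T t i) -> 0 <= work T tau t i.
Proof. by move=> T0; apply: sumr_ge0. Qed.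

(** A lower bound on what any trajectory has paid in the current phase: either it moved, at cost 1,
    or it paid all the work of its state. The task at time [size past] is still to come, hence the
    predecessor. *)
Definition phase_progress T (past : seq S) : R :=
  Num.min 1 (work T (phase_start T (size past)) (size past).-1 (last s1 past)).

(** A move pays 1, which covers any capped progress; staying pays the increase of the work. At the
    end of a phase every state has work at least 1, so a full unit of progress is exchanged for one
    counted phase. *)
Lemma phase_progress_step T past s : (forall t i, 0 <= T t i) -> (0 < size past)%N ->
  (phase_end T (size past))%:R + phase_progress T (rcons past s) <=
  phase_progress T past + step_cost s1 T past s.
Proof.
move=> T0 p0; rewrite /phase_progress /step_cost size_rcons last_rcons /=.
move: (size past) p0 => t t0; set tau := phase_start T t; set s0 := last s1 past.
have tau_t : (tau <= t)%N by exact: phase_start_le.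
have W0 := work_ge0 tau t.-1 s0 T0; have Ts := T0 t s.
have [e|/[dup] e /phase_start_stay ->] := boolP (phase_end T t).
  rewrite phase_start_end // (@work_empty T t.+1) //.
  have : 1 <= work T tau t s.
    move/eqP/setP/(_ s): e; rewrite !inE => /negbFE; exact.
  rewrite work_recr // (min_idPr ler01).
  by case: (eqVneq s0 s) Ts W0 => [<-|_] /=; case: (leP 1 (work T tau t.-1 s0)); lra.
rewrite -/tau [work T tau t s]work_recr //.
case: (eqVneq s0 s) Ts W0 => [<-|_] /=; case: (leP 1 (work T tau t.-1 s0));
  by case: (leP 1 (work T tau t.-1 _ + _)); lra.
Qed.

Lemma phases_le_cost T N sigma : (forall t i, 0 <= T t i) -> size sigma = N ->
  \sum_(1 <= t < N.+1) (phase_end T t)%:R + phase_progress T (s1 :: sigma) <=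
  cost s1 T N sigma.
Proof.
move=> T0; elim: N sigma => [|N IH] sigma.
  move/size0nil ->; rewrite /cost !big_geq // /phase_progress /= phase_start1.
  by rewrite (@work_empty T 1) // add0r ge_min lexx orbT.
case/lastP: sigma => // sigma s; rewrite size_rcons => -[sN].
rewrite big_nat_recr //= cost_rcons // -rcons_cons -addrA.
have := @phase_progress_step T (s1 :: sigma) s T0 isT; rewrite /= sN.
by have := IH _ sN; lra.
Qed.

Lemma phases_le_opt T N : (forall t i, 0 <= T t i) ->
  \sum_(1 <= t < N.+1) (phase_end T t)%:R <= opt_cost s1 T N.
Proof.
move=> T0; apply: opt_cost_ge => sigma.
apply: le_trans (phases_le_cost T0 (size_tuple sigma)); rewrite lerDl.
by rewrite le_min ler01 work_ge0.
Qed.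

Definition min_task T t : R := T t [arg min_(i < s1) T t i]%O.

Lemma min_task_le T t i : min_task T t <= T t i.
Proof. by rewrite /min_task; case: arg_minP => // j _; apply. Qed.

(** The last task of a phase may be arbitrarily expensive in every state, so its cost is charged to
    the optimum separately. *)
Lemma min_task_le_opt T N : (forall t i, 0 <= T t i) ->
  \sum_(1 <= t < N.+1) (phase_end T t)%:R * min_task T t <= opt_cost s1 T N.
Proof.
move=> T0; apply: opt_cost_ge => sigma; apply: ler_sum => t _.
case: phase_end; rewrite ?mul1r ?mul0r ?addr_ge0 // -[leLHS]add0r lerD //.
exact: min_task_le.
Qed.

Lemma saturated_homo T tau i t t' : (forall t i, 0 <= T t i) -> (t <= t')%N ->
  saturated T tau t i -> saturated T tau t' i.
Proof.
move=> T0 tt' /le_trans; apply; have [tau_t|t_tau] := leqP tau t.+1.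
  by rewrite [leRHS](big_cat_nat tau_t) //= lerDl; apply: sumr_ge0.
by rewrite [leLHS]big_geq ?(ltnW t_tau) //; apply: sumr_ge0.
Qed.

Definition saturation_time T tau i : nat := xget 0%N [set t | is_saturation_time T tau i t]%classic.

Lemma saturatedE T tau i u t : (forall t i, 0 <= T t i) -> is_saturation_time T tau i u ->
  saturated T tau t i = (u <= t)%N.
Proof.
move=> T0 [su lu]; have [ut|tu] := leqP u t; first exact: saturated_homo su.
by apply/negbTE/lu.
Qed.

Section Admissible.
Context (eta0 : R) (T : nat -> S -> R) (h : nat -> S -> int).
Context (adm : admissible eta0 T h).

Let T0 t i : 0 <= T t i. Proof. by case: adm. Qed.

Lemma saturation_timeP t i : (0 < t)%N ->
  is_saturation_time T (phase_start T t) i (saturation_time T (phase_start T t) i).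
Proof.
move=> t0; have [_ /(_ _ t0) [_ [ts [tsP _]]]] := adm.
exact: (@xgetI nat 0%N [set u | is_saturation_time T (phase_start T t) i u]%classic (ts i) (tsP i)).
Qed.

Lemma mem_unsaturated t u i : (0 < t)%N ->
  (i \in unsaturated T (phase_start T t) u) = (u < saturation_time T (phase_start T t) i)%N.
Proof.
by move=> t0; rewrite inE (saturatedE _ T0 (saturation_timeP i t0)) ltnNge.
Qed.

Lemma prediction_inj t : (0 < t)%N -> injective (h (phase_index T t)).
Proof. by move=> t0; have [_ /(_ _ t0) []] := adm. Qed.

(** [admissible] bounds the error for some family [ts] of saturation times; first times are unique,
    so [ts] agrees with [saturation_time]. *)
Lemma prediction_error t : (0 < t)%N ->
  (\sum_i `|h (phase_index T t) i - (saturation_time T (phase_start T t) i)%:Z|)%:~R <= eta0.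
Proof.
move=> t0; have [_ /(_ _ t0) [_ [ts [tsP]]]] := adm.
congr (_%:~R <= _); apply: eq_bigr => i _; congr (`| _ - _%:Z|).
have [sx lx] := saturation_timeP i t0; have [sy ly] := tsP i.
apply/eqP; rewrite eqn_leq; apply/andP; split; rewrite leqNgt.
  by apply/negP => /ly; rewrite sx.
by apply/negP => /lx; rewrite sy.
Qed.

End Admissible.

(** Remove a state [x] with least [f]: at most [#|U| - 1] states come after it, and it comes after
    no other state, so the remaining counts do not change. Ties only lower the counts, whence an
    inequality. *)
Lemma sum_harmonic_rank (f : S -> nat) (U : {set S}) :
  \sum_(i in U) @harmonic_number R #|[set j in U | (f i < f j)%N]%SET| <=
  #|U|%:R * harmonic_number #|U| - #|U|%:R.
Proof.
rewrite -sum_harmonic_number; have [n] := ubnP #|U|; elim: n U => // n IH U.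
rewrite ltnS => Un; have [->|[x0 x0U]] := set_0Vmem U.
  by rewrite big_set0 cards0 big_geq.
case: (@arg_minnP _ x0 (fun x => x \in U) f x0U) => x xU xmin.
have cU : #|U| = #|U :\ x|.+1 by rewrite (cardsD1 x) xU.
rewrite cU big_nat_recr //= (big_setD1 x) //= addrC lerD //; last first.
  apply: harmonic_number_homo; apply: subset_leq_card; apply/fintype.subsetP => j.
  by rewrite !inE => /andP[-> fj]; rewrite andbT; apply: contraTneq fj => ->; rewrite ltnn.
apply: le_trans (IH (U :\ x) _); last by rewrite -ltnS -cU.
apply: ler_sum => i; rewrite !inE => /andP[ix iU]; apply: harmonic_number_homo.
apply: subset_leq_card; apply/fintype.subsetP => j; rewrite !inE => /andP[jU fij].
rewrite jU fij !andbT; apply: contraTneq fij => ->; rewrite -leqNgt; exact: xmin.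
Qed.

End Phases.

(** * One step of robust LPS against the potential *)

Section RobustDrift.
Context {R : realType} {S : finType}.
Context (s1 : S).
Implicit Types (T : nat -> S -> R) (h : nat -> S -> int) (past : seq S).
Local Notation H := (@harmonic_number R #|S|).

Lemma cheapestE T t s : s \in cheapest (T t) -> T t s = min_task s1 T t.
Proof.
rewrite inE => /forallP smin; apply/eqP.
by rewrite eq_le min_task_le andbT; apply: smin.
Qed.

Lemma mem_latest_predicted (p : S -> int) (U : {set S}) s :
  s \in latest_predicted p U -> s \in U /\ forall j, j \in U -> p j <= p s.
Proof. by rewrite inE => /andP[sU /'forall_implyP pmax]. Qed.

Section Choices.
Context (T : nat -> S -> R) (h : nat -> S -> int) (past : seq S).
Let t := size past.
Let tau := phase_start T t.
Let U := unsaturated T tau t.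

Lemma robust_LPS_choices_end : phase_end T t ->
  robust_LPS_choices s1 T h past = cheapest (T t).
Proof. by rewrite /phase_end /robust_LPS_choices => ->. Qed.

Lemma robust_LPS_choices_stay : ~~ phase_end T t -> t != tau -> last s1 past \in U ->
  robust_LPS_choices s1 T h past = [set last s1 past]%SET.
Proof.
rewrite /phase_end /robust_LPS_choices -/t -/tau -/U => /negPf -> -> ->.
by [].
Qed.

Lemma robust_LPS_choices_LPS : ~~ phase_end T t -> ~~ ((t != tau) && (last s1 past \in U)) ->
  (phase_transitions s1 past tau)%:R < H ->
  robust_LPS_choices s1 T h past = latest_predicted (h (phase_index T t)) U.
Proof.
by rewrite /phase_end /robust_LPS_choices -/t -/tau -/U => /negPf -> /negPf -> ->.
Qed.

Lemma robust_LPS_choices_oblivious : ~~ phase_end T t ->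
  ~~ ((t != tau) && (last s1 past \in U)) -> H <= (phase_transitions s1 past tau)%:R ->
  robust_LPS_choices s1 T h past = U.
Proof.
rewrite /phase_end /robust_LPS_choices -/t -/tau -/U => /negPf -> /negPf -> /le_gtF ->.
by [].
Qed.

Lemma robust_LPS_choices_gt0 : (0 < #|robust_LPS_choices s1 T h past|)%N.
Proof.
rewrite card_gt0 /robust_LPS_choices -/t -/tau -/U.
case: (eqVneq U finset.set0) => [_|/set0Pn [x xU]].
  apply/set0Pn; exists [arg min_(i < s1) T t i]%O; rewrite inE.
  by apply/forallP => j; apply: min_task_le.
case: ifP => _; first by apply/set0Pn; exists (last s1 past); rewrite inE.
case: ifP => _; last by apply/set0Pn; exists x.
have [y yU ymax] := @arg_maxP _ _ _ x (fun i => i \in U) (h (phase_index T t)) xU.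
by apply/set0Pn; exists y; rewrite inE yU; apply/'forall_implyP.
Qed.

Lemma robust_LPS_choices_unsaturated s : ~~ phase_end T t ->
  s \in robust_LPS_choices s1 T h past -> s \in U.
Proof.
move=> e; rewrite /robust_LPS_choices -/t -/tau -/U (negPf (e : ~~ (U == finset.set0))).
case: ifP => [/andP[_ lU]|_]; first by rewrite inE => /eqP ->.
by case: ifP => // _ /mem_latest_predicted [].
Qed.

Lemma robust_LPS_neq0 s : robust_LPS s1 T h past s != 0 ->
  s \in robust_LPS_choices s1 T h past.
Proof. by rewrite /robust_LPS; case: ifP; rewrite ?eqxx. Qed.

Lemma robust_LPS_mean (f : S -> R) B :
  \sum_(s in robust_LPS_choices s1 T h past) f s <=
    #|robust_LPS_choices s1 T h past|%:R * B ->
  \sum_s robust_LPS s1 T h past s * f s <= B.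
Proof.
move=> fB; rewrite (bigID (mem (robust_LPS_choices s1 T h past))) /= addrC big1 ?add0r; last first.
  by move=> s sC; rewrite /robust_LPS (negPf sC) mul0r.
rewrite (eq_bigr (fun s => #|robust_LPS_choices s1 T h past|%:R^-1 * f s)) => [|s sC].
  by rewrite -mulr_sumr mulrC ler_pdivrMr ?ltr0n ?robust_LPS_choices_gt0 // mulrC.
by rewrite /robust_LPS sC.
Qed.

Lemma robust_LPS_mean_le (f : S -> R) B :
  (forall s, s \in robust_LPS_choices s1 T h past -> f s <= B) ->
  \sum_s robust_LPS s1 T h past s * f s <= B.
Proof. by move=> fB; apply: robust_LPS_mean; rewrite -sum1_card natr_sum mulr_suml ler_sum // => s /fB; rewrite mul1r. Qed.

End Choices.

Lemma robust_LPS_randomized T h : randomized (robust_LPS s1) T h.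
Proof.
split=> [past s|past]; first by rewrite /robust_LPS; case: ifP => // _; rewrite invr_ge0.
rewrite /robust_LPS -big_mkcond /= sumr_const -[_ *+ _]mulr_natl divff // pnatr_eq0.
by rewrite -lt0n robust_LPS_choices_gt0.
Qed.

Lemma phase_transitions_rcons past s tau : (0 < size past)%N -> (tau <= size past)%N ->
  phase_transitions s1 (rcons past s) tau =
  (phase_transitions s1 past tau + (last s1 past != s))%N.
Proof.
move=> p0 tau_p; rewrite /phase_transitions size_rcons big_nat_recr //=; congr (_ + _)%N.
  apply: eq_big_nat => r /andP[_ rp].
  by rewrite !nth_rcons rp (leq_ltn_trans (leq_pred r) rp).
by rewrite !nth_rcons ltnn eqxx prednK // leqnn nth_last.
Qed.

Lemma phase_transitions_start past : phase_transitions s1 past (size past) = 0%N.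
Proof. by rewrite /phase_transitions big_geq. Qed.

Definition outliving T tau s : nat :=
  #|[set j | (saturation_time T tau s < saturation_time T tau j)%N]%SET|.

(** The budget of a whole phase. A transition is charged 2: one for the move and at most one for
    processing in the new state until it saturates. The last 2 pays for the state chosen at the
    first task. *)
Definition phase_cost_bound (B g : R) : R := 2 * B + 2 * g * H + 2.

(* B bounds the transitions made under the LPS rule and g switches on the
   oblivious part: (B, g) is (H + 1, 1) in general, and (2 sqrt eta0, 0) when the
   LPS rule is never abandoned.  The last summand prepays the processing cost
   left in the current state before it saturates. *)
Definition potential (B g : R) T past : R :=
  let t := size past in
  let tau := phase_start T t in
  if t == tau then phase_cost_bound B g else
  2 * Num.max 0 (B - (phase_transitions s1 past tau)%:R)
  + 2 * g * harmonic_number (outliving T tau (last s1 past))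
  + Num.max 0 (1 - work T tau t.-1 (last s1 past)).

Lemma phase_cost_bound_ge0 B g : 0 <= B -> 0 <= g -> 0 <= phase_cost_bound B g.
Proof. by move=> B0 g0; rewrite !addr_ge0 ?mulr_ge0 ?harmonic_number_ge0. Qed.

Lemma potential_ge0 B g T past : 0 <= B -> 0 <= g -> 0 <= potential B g T past.
Proof.
move=> B0 g0; rewrite /potential /=; case: ifP => _; first exact: phase_cost_bound_ge0.
by rewrite !addr_ge0 ?mulr_ge0 ?harmonic_number_ge0 ?le_max ?lexx.
Qed.

Section Drift.
Context (eta0 : R) (T : nat -> S -> R) (h : nat -> S -> int).
Context (adm : admissible eta0 T h).
Context (B g : R) (B0 : 0 <= B) (g0 : 0 <= g).

Let T0 t i : 0 <= T t i. Proof. by case: adm. Qed.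

(** Only the end of a phase brings in new budget; every other step is paid by a drop of the
    potential. The premises keep LPS transitions within [B] and require [g = 1] once the transitions
    reach [H]. *)
Lemma potential_drift past : (0 < size past)%N ->
  let t := size past in
  let tau := phase_start T t in
  let moves := phase_transitions s1 past tau in
  (forall s, ~~ phase_end T t -> moves%:R < H -> s \in robust_LPS_choices s1 T h past ->
     (phase_transitions s1 (rcons past s) tau)%:R <= B) ->
  (~~ phase_end T t -> t != tau -> H <= moves%:R -> g = 1) ->
  \sum_s robust_LPS s1 T h past s * (step_cost s1 T past s + potential B g T (rcons past s))
  <= potential B g T past +
     (phase_end T t)%:R * (phase_cost_bound B g + 1 + min_task s1 T t).
Proof.
move=> t0 t tau moves HB Hg; have tau_t : (tau <= t)%N by exact: phase_start_le.
set s0 := last s1 past.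
have [e|e] := boolP (phase_end T t).
  apply: robust_LPS_mean_le => s; rewrite robust_LPS_choices_end // => /cheapestE Ts.
  have -> : potential B g T (rcons past s) = phase_cost_bound B g.
    by rewrite /potential size_rcons phase_start_end // eqxx.
  have := @potential_ge0 B g T past B0 g0.
  by rewrite mul1r /step_cost Ts; case: (last s1 past != s) => /=; lra.
rewrite mul0r addr0; set U := unsaturated T tau t.
have sU s : s \in robust_LPS_choices s1 T h past -> s \in U.
  exact: robust_LPS_choices_unsaturated.
have H0 : (0 : R) < H.
  by apply: lt_le_trans (harmonic_number_ge1 _) => //; apply/card_gt0P; exists s1.
have satE u i : (i \in unsaturated T tau u) = (u < saturation_time T tau i)%N.
  exact: (mem_unsaturated adm).
have later_n s : harmonic_number (outliving T tau s) <= H.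
  by apply: harmonic_number_homo; apply: max_card.
(* The cost of the task at [t] plus the remainder prepaid after it equals 1 minus the work before
   [t], hence is at most 1. *)
have stepE s : s \in U -> step_cost s1 T past s + potential B g T (rcons past s) <=
    (s0 != s)%:R + 1 + 2 * Num.max 0 (B - (moves + (s0 != s))%:R)
    + 2 * g * harmonic_number (outliving T tau s).
  move=> s_U; have Ws : work T tau t s < 1 by move: s_U; rewrite inE -ltNge.
  rewrite /potential size_rcons phase_start_stay // -/t -/tau gtn_eqF ?ltnS //.
  rewrite last_rcons /= phase_transitions_rcons // -/moves -/s0.
  have -> : Num.max 0 (1 - work T tau t s) = 1 - work T tau t s.
    by apply/max_idPr; rewrite subr_ge0 ltW.
  have := work_recr T s t0 tau_t; have := work_ge0 tau t.-1 s T0.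
  by rewrite /step_cost -/s0 -/t; lra.
have maxB (c : nat) : Num.max 0 (B - c%:R) <= B by rewrite ge_max B0 gerBl ler0n.
have [t_tau|t_tau] := eqVneq t tau.
  apply: robust_LPS_mean_le => s /sU /stepE; move/le_trans; apply.
  rewrite /potential -/t -/tau t_tau eqxx.
  have := maxB (moves + (s0 != s))%N; have := ler_wpM2l g0 (later_n s).
  by rewrite /phase_cost_bound; case: (s0 != s) => /=; lra.
(* When the current state is kept, the processing cost is exactly the drop of the prepaid
   remainder. *)
have [s0U|s0U] := boolP (s0 \in U).
  have Ws : work T tau t s0 < 1 by move: s0U; rewrite inE -ltNge.
  apply: robust_LPS_mean_le => s; rewrite robust_LPS_choices_stay // inE => /eqP ->.
  rewrite -/s0 /potential size_rcons phase_start_stay // -/t -/tau gtn_eqF ?ltnS // (negPf t_tau).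
  rewrite last_rcons -/s0 /= phase_transitions_rcons // -/moves -/s0 eqxx addn0.
  have Wt := work_recr T s0 t0 tau_t.
  have W' : work T tau t.-1 s0 <= 1 by have := T0 t s0; lra.
  have -> : Num.max 0 (1 - work T tau t s0) = 1 - work T tau t s0.
    by apply/max_idPr; rewrite subr_ge0 ltW.
  have -> : Num.max 0 (1 - work T tau t.-1 s0) = 1 - work T tau t.-1 s0.
    by apply/max_idPr; rewrite subr_ge0.
  by rewrite /step_cost -/s0 -/t eqxx /=; lra.
have nstay : ~~ ((t != tau) && (s0 \in U)) by rewrite negb_and s0U orbT.
have s0t : (saturation_time T tau s0 <= t)%N by rewrite leqNgt -satE.
have Phi_ge : 2 * Num.max 0 (B - moves%:R) + 2 * g * harmonic_number (outliving T tau s0)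
    <= potential B g T past.
  by rewrite /potential -/t -/tau (negPf t_tau) -/moves -/s0 lerDl le_max lexx.
have moved s : s \in U -> s0 != s by apply: contraTneq => <-.
(* An LPS transition lowers the first summand by 2, which pays for it; the new state outlives [s0],
   so the harmonic summand does not grow. *)
have [LPS|obl] := ltP moves%:R H.
  apply: robust_LPS_mean_le => s sC; have s_U := sU _ sC.
  apply: le_trans (stepE _ s_U) _; apply: le_trans _ Phi_ge.
  have := HB _ e LPS sC; rewrite phase_transitions_rcons // -/moves -/s0.
  rewrite moved //= natrD => cB.
  have later_le : harmonic_number (outliving T tau s) <=
      harmonic_number (outliving T tau s0) :> R.
    apply: harmonic_number_homo; apply: subset_leq_card; apply/fintype.subsetP => j.
    rewrite !inE; apply: leq_trans; rewrite ltnS; apply: leq_trans s0t _.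
    by apply: ltnW; rewrite -satE.
  have := ler_wpM2l g0 later_le.
  have -> : Num.max 0 (B - (moves%:R + 1%:R)) = B - (moves%:R + 1%:R).
    by apply/max_idPr; rewrite subr_ge0.
  have -> : Num.max 0 (B - moves%:R) = B - moves%:R.
    by apply/max_idPr; rewrite subr_ge0; apply: le_trans cB; rewrite lerDl.
  by lra.
(* For a uniform choice in [U], the mean harmonic number of the ranks is at most that of [#|U|]
   minus 1. Doubled, this saving of 1 pays the charge of 2; and all of [U] outlives [s0]. *)
have g1 : g = 1 by apply: Hg.
apply: robust_LPS_mean; rewrite robust_LPS_choices_oblivious //.
set M := Num.max 0 (B - moves%:R).
apply: le_trans (_ : _ <= \sum_(s in U) (2 + 2 * M +
  2 * harmonic_number #|[set j in U | (saturation_time T tau s < saturation_time T tau j)%N]%SET|)) _.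
  apply: ler_sum => s s_U; apply: le_trans (stepE _ s_U) _.
  (* A state that saturates after the unsaturated [s] is itself unsaturated, so counting within [U]
     loses nothing. *)
  have -> : outliving T tau s =
      #|[set j in U | (saturation_time T tau s < saturation_time T tau j)%N]%SET|.
    congr #|pred_of_set _|; apply/setP => j; rewrite [LHS]inE [RHS]inE satE.
    by case: ltnP => [sj|]; rewrite ?andbF // andbT (ltn_trans _ sj) // -satE.
  rewrite moved //= natrD g1 mulr1 lerD2r lerD // ler_wpM2l //.
  by rewrite ge_max !le_max lexx /= lerD2l lerN2 lerDl ler01 orbT.
rewrite big_split /= -mulr_sumr sumr_const -[_ *+ _]mulr_natl.
have := @sum_harmonic_rank R S (saturation_time T tau) U.
have later_U : harmonic_number #|U| <= harmonic_number (outliving T tau s0) :> R.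
  apply: harmonic_number_homo; apply: subset_leq_card; apply/fintype.subsetP => j.
  by rewrite inE satE; apply: leq_ltn_trans.
have := ler_wpM2l (ler0n R #|U|) later_U.
have := ler_wpM2l (ler0n R #|U|) Phi_ge; rewrite g1 -/M.
by lra.
Qed.

End Drift.
End RobustDrift.

(** * Upper bound on the competitive ratio *)

Section UpperBound.
Context {R : realType} {S : finType}.
Context (s1 : S).
Implicit Types (T : nat -> S -> R) (h : nat -> S -> int) (past : seq S).
Local Notation H := (@harmonic_number R #|S|).

(** Peel off both ends of a list of length [k + 2]: their absolute values sum to at least
    [2 (k + 1)], and twice this is [(k + 2)^2 - k^2]. *)
Lemma abs_sum_ge (d : nat -> int) k : (forall j, (j.+1 < k)%N -> d j + 2 <= d j.+1) ->
  (k * k)%:Z <= 2 * (\sum_(0 <= j < k) `|d j|) + 1.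
Proof.
have [n] := ubnP k; elim: n => // n IH in k d *; case: k => [|[|k]] kn gap.
- by rewrite big_geq.
- by rewrite big_nat1; lia.
have IHk : (k * k)%:Z <= 2 * (\sum_(0 <= j < k) `|d j.+1|) + 1.
  apply: (IH k (fun j => d j.+1)); first by lia.
  by move=> j jk; apply: (gap j.+1); lia.
have telescope m : (m < k.+2)%N -> d 0%N + (2 * m)%:Z <= d m.
  elim: m => [|m IHm] mk; first by rewrite muln0 addr0.
  by have := IHm (ltnW mk); have := gap _ mk; lia.
have := telescope k.+1 (ltnSn _); rewrite big_nat_recl // big_nat_recr //=.
by move: (\sum_(0 <= i < k) _) IHk => X; nia.
Qed.

(** Reads with the most recent state first: [y] was visited before [x], saturated earlier and was
    predicted later. From [x] to [y], the integer [p - sat] grows by at least 2. *)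
Definition LPS_successor (sat : S -> nat) (p : S -> int) : rel S :=
  fun x y => (sat y < sat x)%N && (p x < p y).

Lemma LPS_chain_size (sat : S -> nat) (p : S -> int) (a : seq S) :
  sorted (LPS_successor sat p) a ->
  (size a * size a)%:Z <= 2 * (\sum_i `|p i - (sat i)%:Z|) + 1.
Proof.
(* Distinctness makes the sum of errors along [a] a partial sum of the total error. *)
move=> sa; have ua : uniq a.
  apply: sorted_uniq sa => [y x z|x]; last by rewrite /LPS_successor ltnn.
  move=> /andP[yx pxy] /andP[zy pyz].
  by rewrite /LPS_successor (ltn_trans zy yx) (lt_trans pxy pyz).
apply: le_trans (@abs_sum_ge (fun j => p (nth s1 a j) - (sat (nth s1 a j))%:Z) (size a) _) _.
  by move=> j ja; have /(sortedP s1)/(_ _ ja)/andP[] := sa; lia.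
rewrite lerD2r ler_wpM2l // -(big_nth s1 predT (fun x => `|p x - (sat x)%:Z|)) /=.
rewrite big_uniq //= [leRHS](bigID (mem a)) /= lerDl.
exact: sumr_ge0.
Qed.

Lemma le_twice_sqrt (k : nat) (X : int) (x : R) : 1 <= x ->
  (k * k)%:Z <= 2 * X + 1 -> X%:~R <= x -> k%:R <= 2 * Num.sqrt x.
Proof.
move=> x1 kX Xx; have x0 : 0 <= x by apply: le_trans x1.
rewrite -(@ler_pXn2r _ 2) ?nnegrE ?ler0n ?mulr_ge0 ?sqrtr_ge0 //.
rewrite exprMn sqr_sqrtr // expr2 -natrM.
have : ((k * k)%:Z%:~R : R) <= (2 * X + 1)%:~R by rewrite ler_int.
rewrite rmorphD rmorphM /= -pmulrn => /le_trans; apply.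
by rewrite -[2%:~R]/(2 : R) -[1%:~R]/(1 : R); lra.
Qed.

(* The list a contains the states visited in the phase before the current one,
   most recent first; the first of the size a + 1 states may cost a transition. *)
Definition LPS_chain T h past : Prop :=
  let t := size past in
  let tau := phase_start T t in
  let p := h (phase_index T t) in
  t = tau \/ exists a,
    [/\ (phase_transitions s1 past tau <= (size a).+1)%N,
        path (LPS_successor (saturation_time T tau) p) (last s1 past) a &
        forall j, j \in unsaturated T tau t.-1 -> p j <= p (last s1 past)].

Section Chain.
Context (eta0 : R) (T : nat -> S -> R) (h : nat -> S -> int).
Context (adm : admissible eta0 T h) (eta0_ge1 : 1 <= eta0).

Lemma LPS_chain_transitions past : (0 < size past)%N -> LPS_chain T h past ->
  (phase_transitions s1 past (phase_start T (size past)))%:R <= 2 * Num.sqrt eta0.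
Proof.
move=> t0 [tE|[a [ca pa _]]].
  by rewrite -tE phase_transitions_start mulr_ge0 ?sqrtr_ge0.
apply: (@le_trans _ _ (size a).+1%:R); first by rewrite ler_nat.
apply: le_twice_sqrt eta0_ge1 _ (prediction_error adm t0).
exact: (@LPS_chain_size _ _ (last s1 past :: a) pa).
Qed.

(** The chain itself keeps the transitions below [H], so each new transition still follows the LPS
    rule and extends the chain. *)
Lemma LPS_chain_step past s : 2 * Num.sqrt eta0 < H -> (0 < size past)%N ->
  LPS_chain T h past -> s \in robust_LPS_choices s1 T h past ->
  LPS_chain T h (rcons past s).
Proof.
move=> eta0_H t0 cp sC; have moves_le := LPS_chain_transitions t0 cp.
have moves_H := le_lt_trans moves_le eta0_H.
set t := size past in t0 moves_le moves_H; set tau := phase_start T t in moves_le moves_H.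
have tau_t : (tau <= t)%N by exact: phase_start_le.
rewrite /LPS_chain size_rcons last_rcons -/t.
have [e|e] := boolP (phase_end T t); first by left; rewrite phase_start_end.
right; rewrite phase_start_stay // phase_index_stay // phase_transitions_rcons //= -/tau.
set p := h (phase_index T t); set U := unsaturated T tau t.
have satE u i : (i \in unsaturated T tau u) = (u < saturation_time T tau i)%N.
  exact: (mem_unsaturated adm).
have U_pred j : j \in U -> j \in unsaturated T tau t.-1.
  by rewrite !satE; apply: leq_ltn_trans; exact: leq_pred.
have [t_tau|t_tau] := eqVneq t tau.
  exists [::]; split => //; first by rewrite -t_tau phase_transitions_start; case: (_ != _).
  have nstay : ~~ ((t != tau) && (last s1 past \in U)) by rewrite t_tau eqxx.
  by move: sC; rewrite (robust_LPS_choices_LPS h e nstay moves_H) => /mem_latest_predicted [].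
case: cp => [/eqP|]; first by rewrite -/t -/tau (negPf t_tau).
case=> a []; rewrite -/t -/tau -/p => ca pa pmax.
have [lU|lU] := boolP (last s1 past \in U).
  move: sC; rewrite robust_LPS_choices_stay // inE => /eqP ->.
  exists a; split=> //; first by rewrite eqxx addn0.
  by move=> j /U_pred /pmax.
move: sC; rewrite robust_LPS_choices_LPS -/t -/tau ?negb_and ?lU ?orbT //.
move=> /mem_latest_predicted [sU smax]; exists (last s1 past :: a); split=> //.
  by rewrite /= -[(size a).+2]addn1 leq_add // leq_b1.
(* The last state had the latest prediction among the states unsaturated before this task, [s]
   included. Injectivity makes the comparison strict, as [s] is unsaturated and the last state is
   not. *)
rewrite /= pa andbT /LPS_successor lt_neqAle pmax ?U_pred // andbT.
apply/andP; split; last first.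
  apply: contraNneq lU => /(prediction_inj adm t0) <-; exact: sU.
by move: lU sU; rewrite !satE -leqNgt; apply: leq_ltn_trans.
Qed.

End Chain.

Lemma competitive_le (eta0 w w' : R) (A : @algorithm R S) : w <= w' ->
  competitive s1 eta0 A w -> competitive s1 eta0 A w'.
Proof.
move=> ww' [b wb]; exists b => T h adm N; apply: le_trans (wb _ _ adm N) _.
rewrite lerD2r ler_wpM2r //; apply: opt_cost_ge => sigma.
by apply: sumr_ge0 => t _; rewrite addr_ge0 //; case: adm.
Qed.

(** The drifts sum to [K + 1] per phase plus the minimal last tasks. The number of phases and the
    sum of these minima are each at most the optimum, whence the factor [K + 2]; the initial
    potential [K] is the additive constant. *)
Lemma robust_LPS_competitive (eta0 B g : R) : 0 <= B -> 0 <= g ->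
  (forall T h, admissible eta0 T h -> exists2 Inv,
    reachable_invariant s1 (robust_LPS s1) T h Inv &
    forall past, (0 < size past)%N -> Inv past ->
      let t := size past in
      let tau := phase_start T t in
      let moves := phase_transitions s1 past tau in
      (forall s, ~~ phase_end T t -> moves%:R < H -> s \in robust_LPS_choices s1 T h past ->
        (phase_transitions s1 (rcons past s) tau)%:R <= B) /\
      (~~ phase_end T t -> t != tau -> H <= moves%:R -> g = 1)) ->
  competitive s1 eta0 (robust_LPS s1) (@phase_cost_bound R S B g + 2).
Proof.
move=> B0 g0 inv; set K := @phase_cost_bound R S B g.
exists K => T h adm N; have [Inv rI InvP] := inv T h adm; have T0 := proj1 adm.
apply: le_trans (expected_cost_le (Phi := potential s1 B g T)
  (X := fun t => (phase_end T t)%:R * (K + 1 + min_task s1 T t)) N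
  (robust_LPS_randomized s1 T h) rI (fun past => potential_ge0 s1 T past B0 g0) _) _.
  by move=> past t0 /(InvP _ t0) [HB Hg]; exact: (potential_drift adm B0 g0 t0 HB Hg).
rewrite /potential /= phase_start1 eqxx -/K addrC lerD2r.
under eq_bigr do rewrite mulrDr; rewrite big_split /= -mulr_suml.
have := phases_le_opt s1 N T0; have := min_task_le_opt s1 N T0.
have K1 : 0 <= K + 1 by rewrite addr_ge0 // phase_cost_bound_ge0.
move=> m /(ler_wpM2r K1); lra.
Qed.

(** Fewer than [H] transitions precede any LPS transition, so [B = H + 1] works with the trivial
    invariant. *)
Lemma robust_LPS_competitive_H (eta0 : R) :
  competitive s1 eta0 (robust_LPS s1) (4 * H + 6 : R).
Proof.
apply: (@competitive_le eta0 (@phase_cost_bound R S (H + 1) 1 + 2)).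
  by rewrite /phase_cost_bound; lra.
apply: robust_LPS_competitive => //; first by rewrite addr_ge0 ?harmonic_number_ge0.
move=> T h adm; exists (fun=> True) => // past t0 _ /=; split=> // s _ /ltW mH _.
rewrite phase_transitions_rcons ?phase_start_le // natrD lerD //.
by rewrite lern1 leq_b1.
Qed.

Lemma robust_LPS_competitive_sqrt (eta0 : R) : 1 <= eta0 -> 2 * Num.sqrt eta0 < H ->
  competitive s1 eta0 (robust_LPS s1) (4 * Num.sqrt eta0 + 4).
Proof.
move=> eta0_ge1 eta0_H.
apply: (@competitive_le eta0 (@phase_cost_bound R S (2 * Num.sqrt eta0) 0 + 2)).
  by rewrite /phase_cost_bound; lra.
apply: robust_LPS_competitive => //.
move=> T h adm; exists (LPS_chain T h).
  split; first by left; rewrite phase_start1.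
  move=> past s t0 cp /robust_LPS_neq0; exact: (LPS_chain_step adm eta0_ge1).
move=> past t0 cp t tau moves; have mH := LPS_chain_transitions adm eta0_ge1 t0 cp.
split=> [s e _ sC|_ _]; last by rewrite leNgt (le_lt_trans mH eta0_H).
have := LPS_chain_step adm eta0_ge1 eta0_H t0 cp sC.
move=> /(LPS_chain_transitions adm eta0_ge1 _).
by rewrite size_rcons phase_start_stay //; apply.
Qed.

Lemma robust_LPS_upper (eta0 : R) : (2 <= #|S|)%N -> 1 <= eta0 ->
  competitive s1 eta0 (robust_LPS s1) (24 * Num.min (Num.sqrt eta0) (ln #|S|%:R)).
Proof.
move=> n2 eta0_ge1.
have sq1 : 1 <= Num.sqrt eta0 by rewrite -sqrtr1 ler_wsqrtr.
have ln_half : 2^-1 <= ln #|S|%:R :> R.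
  by apply: le_trans ln2_ge_half _; rewrite ler_ln ?posrE ?ltr0n ?ler_nat // ltnW.
have H_ln : H <= 1 + ln #|S|%:R.
  by rewrite -(ltn_predK n2) harmonic_number_ln.
(* The factor 24 comes from [4 H + 6 <= 4 ln n + 10] and [ln n >= 1/2]; the other comparisons leave
   slack. *)
have [big|small] := leP H (2 * Num.sqrt eta0).
  apply: competitive_le (robust_LPS_competitive_H eta0).
  by case: (leP (Num.sqrt eta0) (ln _)); lra.
apply: competitive_le (robust_LPS_competitive_sqrt eta0_ge1 small).
by case: (leP (Num.sqrt eta0) (ln _)); lra.
Qed.

End UpperBound.

(** * The cyclic instance for the lower bound *)

Section PeriodicInstance.
Context {R : realType} {S : finType}.
Context (s1 : S) (K : nat) (K_gt0 : (0 < K)%N) (K_le : (K <= #|S|)%N).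
Local Notation n := #|S|.
Local Notation H := (@harmonic_number R n).

Let n_gt0 : (0 < n)%N. Proof. exact: leq_trans K_le. Qed.

Let rank (i : S) : nat := enum_rank i.

Let rank_lt i : (rank i < n)%N. Proof. exact: ltn_ord. Qed.

Let rank_inj : injective rank.
Proof. by move=> i j /ord_inj/enum_rank_inj. Qed.

Let rank_onto r : (r < n)%N -> exists i, rank i = r.
Proof. by move=> rn; exists (enum_val (Ordinal rn)); rewrite /rank enum_valK. Qed.

(** Tasks start at time 1, so [t.-1 %% n] is the position in the phase counted from 0. *)
Definition periodic_tasks (t : nat) (i : S) : R := (rank i == t.-1 %% n)%N%:R.

Definition reverse_tail (r : nat) : nat :=
  if (r < n - K)%N then r else (n - K + (n.-1 - r))%N.

(** Without [reverse_tail] this would be the true saturation time of [i] in phase [k]. *)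
Definition reversed_predictions (k : nat) (i : S) : int :=
  (k * n + reverse_tail (rank i)).+1%:Z.

Local Notation T := periodic_tasks.
Local Notation h := reversed_predictions.

Let T0 t i : 0 <= T t i. Proof. exact: ler0n. Qed.

Lemma periodic_work k o i : (o < n)%N ->
  work T (k * n).+1 (k * n + o).+1 i = (rank i <= o)%N%:R.
Proof.
elim: o => [|o IH] on; rewrite work_recr ?ltnS ?leq_addr //.
  by rewrite addn0 work_empty // add0r /T /= modnMl leqn0.
rewrite addnS IH ?(ltnW on) // /T /= -addnS modnMDl modn_small // -natrD; congr _%:R.
by lia.
Qed.

Lemma periodic_saturated k o i : (o < n)%N ->
  saturated T (k * n).+1 (k * n + o).+1 i = (rank i <= o)%N.
Proof.
move=> on; rewrite /saturated -/(work _ _ _ _) periodic_work //.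
by case: (_ <= _)%N; rewrite ?lexx ?ler10.
Qed.

Lemma periodic_phase_end k o : (o < n)%N ->
  (unsaturated T (k * n).+1 (k * n + o).+1 == finset.set0) = (o == n.-1).
Proof.
move=> on; apply/eqP/eqP => [/setP U0|->].
  apply/eqP; rewrite eqn_leq -ltnS prednK // on /= leqNgt.
  apply/negP => o_n; have [x xn] := rank_onto (ltac:(by rewrite prednK) : (n.-1 < n)%N).
  by have := U0 x; rewrite !inE periodic_saturated // xn leqNgt o_n.
apply/setP => i; rewrite !inE periodic_saturated ?prednK //.
by rewrite -ltnS prednK // rank_lt.
Qed.

Lemma periodic_phase t : phase T t.+1 = ((t %/ n)%N, (t %/ n * n)%N.+1).
Proof.
elim: t => [|t IH].
  rewrite div0n mul0n /=; case: eqP => // /setP/(_ s1).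
  by rewrite !inE /saturated big_geq // ler10.
have tE := divn_eq t n; have on := ltn_pmod t n_gt0.
have endE := periodic_phase_end (t %/ n)%N on; rewrite -tE in endE.
have n1 : n = n.-1.+1 by rewrite prednK.
have [e|e] := boolP (phase_end T t.+1).
  rewrite phaseS_end // /phase_index IH /=.
  move: e; rewrite /phase_end /phase_start IH /= endE => /eqP o_n.
  have -> : t.+1 = ((t %/ n).+1 * n)%N by rewrite {1}tE o_n -addnS prednK // mulSn addnC.
  by rewrite mulnK.
rewrite phaseS_stay // IH.
move: e; rewrite /phase_end /phase_start IH /= endE => o_n.
have -> : (t.+1 %/ n = t %/ n)%N; last by [].
rewrite {1}tE -addnS divnMDl // (@divn_small (t %% n).+1) ?addn0 //.
by rewrite -ltn_predRL ltn_neqAle o_n -ltnS prednK.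
Qed.

Lemma periodic_phase_endE t : phase_end T t.+1 = (t %% n == n.-1)%N.
Proof.
have := periodic_phase_end (t %/ n)%N (ltn_pmod t n_gt0).
by rewrite -divn_eq /phase_end /phase_start periodic_phase.
Qed.

Lemma periodic_saturation_time k i :
  is_saturation_time T (k * n).+1 i (k * n + rank i).+1.
Proof.
split=> [|t tk]; first by rewrite periodic_saturated.
have [t_lt|t_ge] := ltnP t (k * n).+1; first by rewrite /saturated big_geq // ler10.
have tE : t = (k * n + (t.-1 - k * n)).+1 by lia.
rewrite tE periodic_saturated; first by lia.
by have := rank_lt i; lia.
Qed.

Lemma reverse_tail_inj r r' : (r < n)%N -> (r' < n)%N ->
  reverse_tail r = reverse_tail r' -> r = r'.
Proof. by rewrite /reverse_tail => rn rn'; case: ltnP => ?; case: ltnP => ?; lia. Qed.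

Lemma sum_rank (V : nmodType) (f : nat -> V) : \sum_i f (rank i) = \sum_(0 <= r < n) f r.
Proof. by rewrite big_mkord (reindex _ (onW_bij _ (@enum_rank_bij S))). Qed.

(** Only the last [K] ranks move, each by less than [K]. *)
Lemma reversed_predictions_error k :
  \sum_i `|h k i - (k * n + rank i).+1%:Z| <= (K * K)%:Z.
Proof.
pose f r : int := `|(reverse_tail r)%:Z - r%:Z|.
rewrite (eq_bigr (fun i => f (rank i))) => [|i _]; last by rewrite /f /h; congr `|_|; lia.
rewrite (sum_rank f) (@big_cat_nat _ _ _ (n - K)) ?leq_subr //=.
rewrite big_nat_cond big1 ?add0r => [|r /andP[/andP[_ rK] _]]; last first.
  by rewrite /f /reverse_tail rK subrr.
apply: (@le_trans _ _ (\sum_(n - K <= r < n) K%:Z)).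
  rewrite big_nat_cond [leRHS]big_nat_cond; apply: ler_sum => r /andP[/andP[rK rn] _].
  by rewrite /f /reverse_tail ltnNge rK /=; lia.
by rewrite sumr_const_nat subKn // -[_ *+ _]mulr_natl natz PoszM.
Qed.

Lemma periodic_admissible (eta0 : R) : (K * K)%:R <= eta0 -> admissible eta0 T h.
Proof.
move=> K_eta0; split=> // -[//|t] _; rewrite /phase_index /phase_start periodic_phase /=.
split=> [i j /= []|].
  by move/addnI/reverse_tail_inj => /(_ (rank_lt i) (rank_lt j))/rank_inj.
exists (fun i => (t %/ n * n + rank i)%N.+1); split=> [i|]; first exact: periodic_saturation_time.
apply: le_trans K_eta0; rewrite pmulrn ler_int; exact: reversed_predictions_error.
Qed.

(** Predictions decrease along the last [K] ranks and exceed those of all earlier ranks, so the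
    latest one belongs to the smallest unsaturated rank of the tail. *)
Lemma latest_reversed_prediction k o s (U : {set S}) : (o.+1 < n)%N ->
  (forall i, (i \in U) = (o < rank i)%N) ->
  s \in latest_predicted (h k) U -> rank s = maxn (n - K) o.+1.
Proof.
move=> on UE /mem_latest_predicted [sU smax].
have [x xE] : exists x, rank x = maxn (n - K) o.+1 by apply: rank_onto; lia.
have : h k x <= h k s by apply: smax; rewrite UE xE; lia.
move: sU; rewrite UE /h lez_nat xE ltnS leq_add2l /reverse_tail.
have sn := rank_lt s; move=> os.
by case: (ltnP (rank s)) => ?; case: (ltnP (maxn _ _)) => ?; lia.
Qed.


(* Here t tasks have been processed and t %% n of them belong to the current
   phase; at t %% n = 0 nothing is claimed, since the last task of a phase is
   processed in a random state. *)
Definition follows_tail (past : seq S) : Prop :=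
  let t := (size past).-1 in
  (t %% n = 0)%N \/
  rank (last s1 past) = maxn (n - K) (t %% n) /\
  (phase_transitions s1 past (t %/ n * n)%N.+1 <= (t %% n - (n - K)).+1)%N.

Lemma follows_tail_step past s : K.-1%:R < H -> (0 < size past)%N ->
  follows_tail past -> s \in robust_LPS_choices s1 T h past ->
  follows_tail (rcons past s).
Proof.
move=> K_H; case tE: (size past) => [//|t] _; rewrite /follows_tail size_rcons tE /=.
have on := ltn_pmod t n_gt0.
have [e|e] := boolP (phase_end T t.+1).
  move: (e); rewrite periodic_phase_endE => /eqP o_n _ _; left.
  have -> : t.+1 = ((t %/ n).+1 * n)%N by rewrite {1}(divn_eq t n) o_n -addnS prednK // mulSn addnC.
  by rewrite modnMl.
have {on} on : ((t %% n).+1 < n)%N.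
  by rewrite -ltn_predRL ltn_neqAle -ltnS prednK // on andbT -periodic_phase_endE.
have -> : (t.+1 %% n = (t %% n).+1)%N.
  by rewrite {1}(divn_eq t n) -addnS modnMDl modn_small.
have -> : (t.+1 %/ n = t %/ n)%N.
  by rewrite {1}(divn_eq t n) -addnS divnMDl // (divn_small on) addn0.
have stE : phase_start T (size past) = (t %/ n * n)%N.+1.
  by rewrite tE /phase_start periodic_phase.
have kE : phase_index T (size past) = (t %/ n)%N by rewrite tE /phase_index periodic_phase.
rewrite -tE in e.
set U := unsaturated T (phase_start T (size past)) (size past).
have UE i : (i \in U) = (t %% n < rank i)%N.
  rewrite /U stE tE inE {2}(divn_eq t n) periodic_saturated ?ltn_pmod //.
  by rewrite ltnNge.
rewrite last_rcons phase_transitions_rcons ?tE // ?ltnS ?leq_trunc_div //.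
have LPS_step : ~~ ((size past != phase_start T (size past)) && (last s1 past \in U)) ->
    (phase_transitions s1 past (phase_start T (size past)) <= K.-1)%N ->
    s \in robust_LPS_choices s1 T h past -> rank s = maxn (n - K) (t %% n).+1.
  move=> nstay moves; rewrite robust_LPS_choices_LPS //; last first.
    by apply: le_lt_trans K_H; rewrite ler_nat.
  by rewrite kE; apply: latest_reversed_prediction.
have at_start : (t %% n = 0)%N -> size past = phase_start T (size past).
  by move=> eo; rewrite stE tE {1}(divn_eq t n) eo addn0.
have [ eo | o_gt0] := posnP (t %% n)%N.
  have moves0 : phase_transitions s1 past (t %/ n * n)%N.+1 = 0%N.
    by rewrite -stE -(at_start eo) phase_transitions_start.
  move=> _ /LPS_step step; right; split.
    by apply: step; rewrite ?stE ?moves0 // -stE -(at_start eo) eqxx.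
  by rewrite moves0; case: (_ != _); lia.
case=> [eo|[last_rank moves]]; first by rewrite eo in o_gt0.
have not_start : size past != phase_start T (size past).
  by rewrite stE tE eqSS {1}(divn_eq t n) -[X in _ != X]addn0 eqn_add2l -lt0n.
have [lU|lU] := boolP (last s1 past \in U).
  rewrite robust_LPS_choices_stay // inE => /eqP ->; right.
  rewrite eqxx addn0 last_rank; move: lU moves; rewrite UE last_rank.
  by move: (t %% n)%N (phase_transitions _ _ _) => o q lU moves; split; lia.
move=> sC; right.
have nstay : ~~ ((size past != phase_start T (size past)) && (last s1 past \in U)).
  by rewrite (negPf lU) andbF.
(* Leaving a saturated state here means [n - K <= t %% n <= n - 2], so the invariant allows at most
   [K - 1] earlier transitions and [K_H] keeps the LPS rule in force. *)
have moves_K : (phase_transitions s1 past (t %/ n * n)%N.+1 <= K.-1)%N.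
  move: lU moves on; rewrite UE last_rank -leqNgt geq_max leqnn andbT; move: K_gt0 K_le.
  by move: #|S| (t %% n)%N (phase_transitions _ _ _) => N o q *; lia.
split; first by apply: LPS_step; rewrite // stE.
move: lU moves on; rewrite UE last_rank -leqNgt geq_max leqnn andbT.
by move: #|S| (t %% n)%N (phase_transitions _ _ _) => N o q lU moves on; case: (_ != _); lia.
Qed.

Lemma follows_tail_invariant : K.-1%:R < H ->
  reachable_invariant s1 (robust_LPS s1) T h follows_tail.
Proof.
move=> K_H; split; first by left; rewrite mod0n.
move=> past s t0 fp /robust_LPS_neq0; exact: follows_tail_step.
Qed.

(** Strictly inside the tail the invariant forces consecutive ranks before and after the step, hence
    a move. *)
Lemma follows_tail_move past s : K.-1%:R < H -> (0 < size past)%N ->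
  follows_tail past -> robust_LPS s1 T h past s != 0 ->
  (n - K < (size past).-1 %% n < n.-1)%N%:R <= step_cost s1 T past s.
Proof.
move=> K_H t0 fp sC; have := proj2 (follows_tail_invariant K_H) _ _ t0 fp sC.
have Ts := T0 (size past) s; have b0 (b : bool) : (0 : R) <= b%:R by [].
case: (boolP (_ < _ < _)%N) => [|_ _]; last by rewrite addr_ge0.
move: fp t0; case tE: (size past) => [//|t] fp _ /= /andP[K_o o_n].
move: fp; rewrite /follows_tail size_rcons tE /= last_rcons.
have o1 : (t.+1 %% n = (t %% n).+1)%N.
  by rewrite {1}(divn_eq t n) -addnS modnMDl modn_small // -ltn_predRL.
rewrite o1 => -[eo|[last_rank _]]; first by rewrite eo in K_o.
case=> [//|[s_rank _]].
rewrite /step_cost tE in Ts *; have -> : last s1 past != s.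
    apply/eqP => ls; move: s_rank K_o; rewrite -ls last_rank.
  by move: (t %% n)%N => o; lia.
by rewrite lerDl.
Qed.

Lemma sum_periodic (f : nat -> R) p :
  \sum_(1 <= t < (p * n).+1) f (t.-1 %% n)%N = p%:R * \sum_(0 <= o < n) f o.
Proof.
rewrite big_add1 /=; elim: p => [|p IH]; first by rewrite big_geq // mul0r.
rewrite (@big_cat_nat _ _ _ (p * n)) ?leq_mul2r ?leqnSn ?orbT //= IH.
rewrite -natr1 mulrDl mul1r; congr (_ + _).
rewrite mulSn -{1}[(p * n)%N]add0n big_addn addnK.
by apply: eq_big_nat => o /andP[_ on]; rewrite addnC modnMDl modn_small.
Qed.

Lemma sum_single c : (c < n)%N -> \sum_(0 <= o < n) (c == o)%:R = 1 :> R.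
Proof.
move=> cn; rewrite big_mkord (bigD1 (Ordinal cn)) //= eqxx big1 ?addr0 // => o o_c.
by case: eqP => // co; case/eqP: o_c; apply: val_inj.
Qed.

Lemma sum_tail : K%:R - 2 <= \sum_(0 <= o < n) (n - K < o < n.-1)%N%:R :> R.
Proof.
have tail a m : (m%:R - a%:R - 1 : R) <= \sum_(0 <= o < m) (a < o)%N%:R.
  elim: m => [|m IH]; first by rewrite big_geq // sub0r; have := ler0n R a; lra.
  rewrite big_nat_recr //= -natr1; case: (ltnP a m) => [_|ma] /=; first by lra.
  have : 0 <= \sum_(0 <= o < m) (a < o)%N%:R :> R by apply: sumr_ge0.
  have : (m%:R : R) <= a%:R by rewrite ler_nat.
  by lra.
rewrite -[X in \sum_(0 <= o < X) _](prednK n_gt0) big_nat_recr //= ltnn andbF addr0.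
apply: le_trans (_ : _ <= \sum_(0 <= o < n.-1) (n - K < o)%N%:R) _; last first.
  by rewrite le_eqVlt; apply/orP; left; apply/eqP; apply: eq_big_nat => o /andP[_ ->]; rewrite andbT.
have nE : n%:R = n.-1%:R + 1 :> R by rewrite natr1 prednK.
by apply: le_trans (tail _ _); rewrite natrB // nE; lra.
Qed.

(** Staying in [s1] pays one unit task per phase, which matches the offline lower bound of 1 per
    phase. *)
Lemma periodic_opt p : opt_cost s1 T (p * n) = p%:R.
Proof.
apply/eqP; rewrite eq_le; apply/andP; split.
  apply: le_trans (opt_cost_le s1 (nseq_tuple (p * n) s1) T0) _.
  have stay t : state_at s1 (nseq (p * n) s1) t = s1.
    by rewrite /state_at; case: t => //= t; rewrite nth_nseq if_same.
  rewrite /cost (eq_bigr (fun t => (rank s1 == t.-1 %% n)%N%:R)) => [|t _].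
    by rewrite (sum_periodic (fun o => (rank s1 == o)%:R)) sum_single ?mulr1.
  by rewrite !stay eqxx add0r.
apply: le_trans (phases_le_opt s1 _ T0).
have -> : \sum_(1 <= t < (p * n).+1) (phase_end T t)%:R =
    \sum_(1 <= t < (p * n).+1) (n.-1 == t.-1 %% n)%N%:R :> R.
  by apply: eq_big_nat => -[//|t] _; rewrite periodic_phase_endE eq_sym.
by rewrite (sum_periodic (fun o => (n.-1 == o)%:R)) sum_single ?mulr1 ?prednK.
Qed.

(** The walk through the tail gives [K - 2] forced moves per phase; for small [K] the comparison
    with the optimum gives 1. *)
Lemma periodic_expected_cost p : K.-1%:R < H ->
  p%:R * Num.max 1 (K%:R - 2) <= expected_cost s1 (robust_LPS s1) T h (p * n).
Proof.
move=> K_H; rewrite maxr_pMr // ge_max mulr1; apply/andP; split.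
  rewrite -periodic_opt; apply: opt_cost_le_expected_cost => //.
  exact: robust_LPS_randomized.
have := expected_cost_ge (X := fun t => (n - K < t.-1 %% n < n.-1)%N%:R)
  (p * n) (robust_LPS_randomized s1 T h) (follows_tail_invariant K_H)
  (fun past s => @follows_tail_move past s K_H).
apply: le_trans; rewrite (sum_periodic (fun o => (n - K < o < n.-1)%N%:R)).
by rewrite ler_wpM2l // sum_tail.
Qed.

(** If [w < M], the additive constant would have to absorb [p * (M - w)] for every number [p] of
    phases. *)
Lemma competitive_ge (eta0 w : R) : K.-1%:R < H -> (K * K)%:R <= eta0 ->
  competitive s1 eta0 (robust_LPS s1) w -> Num.max 1 (K%:R - 2) <= w.
Proof.
move=> K_H K_eta0 [b wb]; set M := Num.max 1 _; rewrite leNgt; apply/negP => wM.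
have le_b p : p%:R * (M - w) <= b.
  have := wb _ _ (periodic_admissible K_eta0) (p * n)%N.
  rewrite periodic_opt; have := periodic_expected_cost p K_H; rewrite -/M.
  by rewrite mulrBr; lra.
have := le_b (Num.trunc (b / (M - w))).+1; apply/negP; rewrite -ltNge.
by rewrite -ltr_pdivrMr ?subr_gt0 // truncnS_gt.
Qed.

End PeriodicInstance.

(** * Choice of the tail length and the asymptotic bounds *)

Lemma robust_LPS_lower (R : realType) (S : finType) (s1 : S) (eta0 w : R) :
  (2 <= #|S|)%N -> 1 <= eta0 -> competitive s1 eta0 (robust_LPS s1) w ->
  6^-1 * Num.min (Num.sqrt eta0) (ln #|S|%:R) <= w.
Proof.
move=> n2 eta0_ge1; set m := Num.min _ _.
have n_gt0 : (0 < #|S|)%N by apply: ltn_trans n2.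
have sq1 : 1 <= Num.sqrt eta0 by rewrite -sqrtr1 ler_wsqrtr.
have ln0 : 0 <= ln #|S|%:R :> R by rewrite ln_ge0 // ler1n.
have m0 : 0 <= m by rewrite le_min ln0 (le_trans ler01).
have m_ln : m <= ln #|S|%:R by rewrite ge_min lexx orbT.
have m_sq : m <= Num.sqrt eta0 by rewrite ge_min lexx.
have /andP[tr_m m_tr] := truncn_itv m0.
(* The largest scale compatible with [K * K <= eta0] and [K - 1 < H]; the truncation is 0 when
   [ln #|S| < 1], while the tail must be nonempty. *)
set K := maxn 1 (Num.trunc m).
have K_sq : K%:R <= Num.sqrt eta0.
  by rewrite /K; case: leqP => _ //; apply: le_trans m_sq.
have K_n : (K <= #|S|)%N.
  rewrite geq_max n_gt0 -(ler_nat R) (le_trans tr_m) // (le_trans m_ln) //.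
  by apply/ltW/ln_sublinear; rewrite ltr0n.
have K_H : K.-1%:R < harmonic_number #|S| :> R.
  have H1 := @harmonic_number_ge1 R _ n_gt0.
  have : ln #|S|%:R <= harmonic_number #|S| :> R.
    rewrite -{1}(prednK n_gt0); apply: le_trans (ln_harmonic_number _) _.
    by apply: harmonic_number_homo; exact: leq_pred.
  rewrite /K; case: (leqP 1 (Num.trunc m)) => [|_ _]; last by rewrite mulr0n; lra.
  by case: (Num.trunc m) tr_m => // k; rewrite -natr1 /=; lra.
have K_eta0 : (K * K)%:R <= eta0.
  rewrite natrM -expr2 -[leRHS]sqr_sqrtr; last by apply: le_trans eta0_ge1.
  by rewrite ler_pXn2r ?nnegrE ?sqrtr_ge0.
move=> /(competitive_ge (leq_maxl 1 _ : (0 < K)%N) K_n K_H K_eta0).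
apply: le_trans; have m_K : m < K%:R + 1.
  by apply: lt_le_trans m_tr _; rewrite natr1 ler_nat ltnS leq_maxr.
have K_cases : K%:R <= 2 :> R \/ 3 <= K%:R :> R.
  by have [K2|K3] := leqP K 2; [left | right]; rewrite ler_nat.
(* If [K <= 2] then [m < 3] and the bound 1 suffices; if [K >= 3] then [m < K + 1 <= 4 (K - 2)]. *)
by case: (leP 1 (K%:R - 2)); case: K_cases; lra.
Qed.

(** For a single state, or for [eta0] tending to 0, the minimum vanishes while the ratio stays at
    least 1; the side conditions exclude these degenerate cases. *)
Theorem mainTheorem4 (R : realType) :
  exists c C : R, 0 < c /\ 0 < C /\
    forall (S : finType) (s1 : S) (eta0 : R), (2 <= #|S|)%N -> 1 <= eta0 ->
      let m : R := Num.min (Num.sqrt eta0) (ln #|S|%:R) in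
      ((c * m)%:E <= competitive_ratio s1 eta0 (robust_LPS s1))%E /\
      (competitive_ratio s1 eta0 (robust_LPS s1) <= (C * m)%:E)%E.
Proof.
exists 6^-1, 24; split; first by rewrite invr_gt0.
split=> // S s1 eta0 n2 eta0_ge1 m; split.
  by apply: le_ereal_inf_tmp => _ [w wc <-]; rewrite lee_fin; apply: robust_LPS_lower wc.
apply: ereal_inf_lbound; exists (24 * m) => //; exact: robust_LPS_upper.
Qed.
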